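(* Let $\Omega_c$ be a commutative semigroup and let $(A,\prec_{\omega_1,\omega_2},\succ_{\omega_1,\omega_2},\Omega_c)$ be an $\Omega_c$-relative pre-anti-flexible algebra, and put $x\circledast_{\alpha,\beta}y = x\prec_{\alpha,\beta}y + x\succ_{\alpha,\beta}y$. Then the products $$[x,y]_{\alpha,\beta} := x\circledast_{\alpha,\beta}y - y\circledast_{\beta,\alpha}x = (x\succ_{\alpha,\beta}y + x\prec_{\alpha,\beta}y) - (y\succ_{\beta,\alpha}x + y\prec_{\beta,\alpha}x)\qquad(x,y\in A,\ \alpha,\beta\in\Omega_c)$$ define an $\Omega_c$-relative Lie algebra structure on $A$.
   Context: Standing conventions: $\Omega_c$ is a commutative associative semigroup; $A$ is a finite-dimensional vector space over a field of characteristic zero; all operations on $A$ are bilinear. An $\Omega_c$-relative pre-anti-flexible algebra is a vector space $A$ with bilinear operations $\prec_{\alpha,\beta},\succ_{\alpha,\beta}:A\times A\to A$ for each $(\alpha,\beta)\in\Omega_c^2$ such that for all $x,y,z\in A$ and $\alpha,\beta,\gamma\in\Omega_c$: $$(x\succ_{\alpha,\beta}y)\prec_{\alpha\beta,\gamma}z - x\succ_{\alpha,\beta\gamma}(y\prec_{\beta,\gamma}z) = (z\succ_{\gamma,\beta}y)\prec_{\gamma\beta,\alpha}x - z\succ_{\gamma,\beta\alpha}(y\prec_{\beta,\alpha}x),$$ $$(x\prec_{\alpha,\beta}y + x\succ_{\alpha,\beta}y)\succ_{\alpha\beta,\gamma}z - x\succ_{\alpha,\beta\gamma}(y\succ_{\beta,\gamma}z)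 = (z\prec_{\gamma,\beta}y)\prec_{\gamma\beta,\alpha}x - z\prec_{\gamma,\beta\alpha}(y\prec_{\beta,\alpha}x + y\succ_{\beta,\alpha}x).$$ An $\Omega_c$-relative Lie algebra is a vector space $A$ with a bilinear operation $[\cdot,\cdot]_{\alpha,\beta}$ for each pair $(\alpha,\beta)\in\Omega_c^2$ such that for all $x,y,z\in A$ and $\alpha,\beta,\gamma\in\Omega_c$: $$[x,y]_{\alpha,\beta}+[y,x]_{\beta,\alpha}=0,$$ $$[[x,y]_{\alpha,\beta},z]_{\alpha\beta,\gamma}+[[y,z]_{\beta,\gamma},x]_{\beta\gamma,\alpha}+[[z,x]_{\gamma,\alpha},y]_{\gamma\alpha,\beta}=0.$$ *)

(* Defs.v *)
From HB Require Import structures.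
From mathcomp Require Import all_boot all_algebra.

Set Implicit Arguments.
Unset Strict Implicit.
Unset Printing Implicit Defensive.

Import GRing.Theory.
Local Open Scope ring_scope.

Definition op_family (O A : Type) : Type := O -> O -> A -> A -> A.

(* The operation of a [semigroupType] is written multiplicatively, in %g.
   Commutativity of O is not built into the two structures below. *)

Record relative_pre_anti_flexible (O : semigroupType) (K : fieldType)
    (A : lmodType K) (prec succ : op_family O A) : Prop :=
  RelativePreAntiFlexible {
    rpaf_prec_bilinear : forall a b, bilinear_for *:%R *:%R (prec a b);
    rpaf_succ_bilinear : forall a b, bilinear_for *:%R *:%R (succ a b);
    rpaf_succ_prec : forall (a b c : O) (x y z : A),
      prec (a * b)%g c (succ a b x y) z - succ a (b * c)%g x (prec b c y z)
      = prec (c * b)%g a (succ c b z y) x - succ c (b * a)%g z (prec b a y x);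
    rpaf_succ_succ : forall (a b c : O) (x y z : A),
      succ (a * b)%g c (prec a b x y + succ a b x y) z
        - succ a (b * c)%g x (succ b c y z)
      = prec (c * b)%g a (prec c b z y) x
        - prec c (b * a)%g z (prec b a y x + succ b a y x)
  }.

Record relative_lie (O : semigroupType) (K : fieldType)
    (A : lmodType K) (br : op_family O A) : Prop :=
  RelativeLie {
    rlie_bilinear : forall a b, bilinear_for *:%R *:%R (br a b);
    rlie_antisymmetry : forall (a b : O) (x y : A),
      br a b x y + br b a y x = 0;
    rlie_jacobi : forall (a b c : O) (x y z : A),
      br (a * b)%g c (br a b x y) z + br (b * c)%g a (br b c y z) x
        + br (c * a)%g b (br c a z x) y = 0
  }.

Definition circledast (O : Type) (A : zmodType) (prec succ : op_family O A) :
    op_family O A :=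
  fun a b x y => prec a b x y + succ a b x y.

(* Swapping the arguments also swaps the indices. *)
Definition relative_commutator (O : Type) (A : zmodType) (m : op_family O A) :
    op_family O A :=
  fun a b x y => m a b x y - m b a y x.

(* Main.v *)
(* The product [x * y = x < y + x > y] is anti-flexible: its associator is
   symmetric under exchanging the first and third argument, since the second
   axiom turns the part [(x * y) > z - x > (y > z)] of it into the part
   [(z < y) < x - z < (y * x)] of the reversed associator, and the first axiom
   says that the remaining part is symmetric.  By commutativity of the index
   semigroup the Jacobi sum of the commutator is the alternating sum of the six
   associators, which cancel in pairs. *)
Require Import Defs.
From HB Require Import structures.
From mathcomp Require Import all_boot all_algebra.

Set Implicit Arguments.
Unset Strict Implicit.
Unset Printing Implicit Defensive.

Import GRing.Theory.
Local Open Scope ring_scope.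

Definition relative_associator (O : semigroupType) (A : zmodType)
    (m : op_family O A) (a b c : O) (x y z : A) : A :=
  m (a * b)%g c (m a b x y) z - m a (b * c)%g x (m b c y z).

(** The part of bilinearity that the Jacobi computation uses; it lets that lemma be stated over a
    [zmodType]. *)
Definition biadditive (A : zmodType) (f : A -> A -> A) : Prop :=
  left_distributive f +%R /\ right_distributive f +%R.

Section Bilinear.
Variables (K : fieldType) (A : lmodType K).
Implicit Types f g : A -> A -> A.

Lemma bilinear_biadditive f : bilinear_for *:%R *:%R f -> biadditive f.
Proof.
case=> fl fr; split=> [x y z | x y z].
  by have := fl z 1 x y; rewrite /= !scale1r.
by have := fr x 1 y z; rewrite /= !scale1r.
Qed.

Lemma bilinear_add f g :
  bilinear_for *:%R *:%R f -> bilinear_for *:%R *:%R g ->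
  bilinear_for *:%R *:%R (fun x y => f x y + g x y).
Proof.
case=> fl fr [gl gr]; split=> u k x y /=.
  by rewrite [f _ u]fl [g _ u]gl scalerDr addrACA.
by rewrite fr gr scalerDr addrACA.
Qed.

(** The swap exchanges the two slots of [g], so linearity of [f] on one side is paired with
    linearity of [g] on the other. *)
Lemma bilinear_sub_swap f g :
  bilinear_for *:%R *:%R f -> bilinear_for *:%R *:%R g ->
  bilinear_for *:%R *:%R (fun x y => f x y - g y x).
Proof.
case=> fl fr [gl gr]; split=> u k x y /=.
  by rewrite [f _ u]fl gr scalerBr opprD addrACA.
by rewrite fr [g _ u]gl scalerBr opprD addrACA.
Qed.

End Bilinear.

Lemma biadditiveBl (A : zmodType) (f : A -> A -> A) :
  biadditive f -> left_distributive f (fun x y => x - y).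
Proof. by case=> fD _ x y z; apply/eqP; rewrite eq_sym subr_eq -fD subrK. Qed.

Lemma biadditiveBr (A : zmodType) (f : A -> A -> A) :
  biadditive f -> right_distributive f (fun x y => x - y).
Proof. by case=> _ fD x y z; apply/eqP; rewrite eq_sym subr_eq -fD subrK. Qed.

Lemma relative_associator_circledast (O : semigroupType) (K : fieldType)
    (A : lmodType K) (prec succ : op_family O A) :
    relative_pre_anti_flexible prec succ ->
  forall (a b c : O) (x y z : A),
    relative_associator (circledast prec succ) a b c x y z
    = relative_associator (circledast prec succ) c b a z y x.
Proof.
move=> [precB succB succ_prec succ_succ].
(* The first and third groups are the left sides of the two axioms; the second is the right side of
   the second axiom with the triple reversed. *)
have expand a b c x y z :
    relative_associator (circledast prec succ) a b c x y z
    = (prec (a * b)%g c (succ a b x y) z - succ a (b * c)%g x (prec b c y z))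
      + (prec (a * b)%g c (prec a b x y) z
         - prec a (b * c)%g x (prec b c y z + succ b c y z))
      + (succ (a * b)%g c (prec a b x y + succ a b x y) z
         - succ a (b * c)%g x (succ b c y z)).
  rewrite /relative_associator /circledast.
  (* Only these two outer products are distributed; the other two keep their inner sums, as in the
     second axiom. *)
  have [precDl _] := bilinear_biadditive (precB (a * b)%g c).
  have [_ succDr] := bilinear_biadditive (succB a (b * c)%g).
  rewrite precDl succDr !opprD.
  by rewrite !addrA [LHS](ACl (2*5*1*4*3*6))%AC.
(* The first groups now agree, and each third group has become the second group of the opposite
   side, so the sides differ by a transposition. *)
move=> a b c x y z; rewrite !expand succ_prec !succ_succ.
exact: addrAC.
Qed.

(** An indexed form of the Lie-admissibility of anti-flexible algebras. *)
Lemma relative_commutator_jacobi (O : semigroupType) (A : zmodType)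
    (m : op_family O A) :
    (forall a b : O, (a * b)%g = (b * a)%g) ->
    (forall a b, biadditive (m a b)) ->
    (forall a b c x y z, relative_associator m a b c x y z
                         = relative_associator m c b a z y x) ->
  let br := relative_commutator m in
  forall (a b c : O) (x y z : A),
    br (a * b)%g c (br a b x y) z + br (b * c)%g a (br b c y z) x
      + br (c * a)%g b (br c a z x) y = 0.
Proof.
move=> O_comm mD m_flex br a b c x y z.
(* Commutativity is used to reindex, so that each of the four products is literally one half of an
   associator. *)
have expand a' b' c' x' y' z' : br (a' * b')%g c' (br a' b' x' y') z'
    = (m (a' * b')%g c' (m a' b' x' y') z'
       - m (b' * a')%g c' (m b' a' y' x') z')
      + (m c' (b' * a')%g z' (m b' a' y' x')
         - m c' (a' * b')%g z' (m a' b' x' y')).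
  rewrite /br /relative_commutator (biadditiveBl (mD _ _)).
  by rewrite (biadditiveBr (mD _ _)) opprB (O_comm b' a').
(* Cyclic orders of the triple carry a plus sign; each is paired with its reversal, which carries a
   minus sign. The six associators have twelve halves, one for each product in the Jacobi sum. *)
transitivity ((relative_associator m a b c x y z
                 - relative_associator m c b a z y x)
              + (relative_associator m b c a y z x
                 - relative_associator m a c b x z y)
              + (relative_associator m c a b z x y
                 - relative_associator m b a c y x z)); last first.
  by rewrite (m_flex a b c) (m_flex b c a) (m_flex c a b) !subrr !addr0.
rewrite !expand /relative_associator !opprB.
by rewrite !addrA [LHS](ACl (1*8*3*6*5*12*7*10*9*4*11*2))%AC.
Qed.

Theorem theorem3p9 (O : semigroupType)
    (O_comm : forall a b : O, (a * b)%g = (b * a)%g)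
    (K : fieldType) (K_char0 : [pchar K] =i pred0)
    (A : vectType K) (prec succ : op_family O A)
    (A_paf : relative_pre_anti_flexible prec succ) :
  let br := relative_commutator (circledast prec succ) in
  (forall (a b : O) (x y : A),
     br a b x y = (succ a b x y + prec a b x y)
                  - (succ b a y x + prec b a y x))
  /\ relative_lie br.
Proof.
have mB a b : bilinear_for *:%R *:%R (circledast prec succ a b).
  by apply: bilinear_add; [apply: rpaf_prec_bilinear A_paf _ _
                          | apply: rpaf_succ_bilinear A_paf _ _].
move=> br; split=> [a b x y|].
  by congr (_ - _); rewrite /circledast addrC.
split=> [a b|a b x y|].
- exact: bilinear_sub_swap.
- by rewrite /br /relative_commutator addrA subrK subrr.
apply: relative_commutator_jacobi => // [a b|].
  exact: bilinear_biadditive.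
exact: relative_associator_circledast.
Qed.
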